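(* Let $G$ be a simple graph of order $n$ with $m\ge\frac{n}{2}$ edges and maximum degree $\Delta_1$, not isomorphic to $K_{1,n-r-1}\cup rK_1$ for any $r$ with $0\le r\le\lceil n/2\rceil-2$ or $r=n-2$. Then $LE(G)\le 4m-2\Delta_1-\frac{8m}{n}+4$.
   Context: For a graph $G$ with $n$ vertices and $m$ edges, let $\mu_1\ge\cdots\ge\mu_n=0$ be the eigenvalues of the Laplacian matrix $L(G)=D(G)-A(G)$. The Laplacian energy is $LE(G)=\sum_{i=1}^n\left|\mu_i-\frac{2m}{n}\right|$. $K_{1,p}$ is the star with $p$ leaves, $rK_1$ is $r$ isolated vertices, $\cup$ is disjoint union. *)

(* Defs.v *)
From mathcomp Require Import all_boot all_order all_algebra.
From mathcomp Require Import spectral complex.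

Set Implicit Arguments.
Unset Strict Implicit.
Unset Printing Implicit Defensive.

Import Order.TTheory GRing.Theory Num.Theory.
Local Open Scope ring_scope.

Record sgraph := SGraph {
  vertex :> finType;
  adj : rel vertex;
  adj_sym : symmetric adj;
  adj_irr : irreflexive adj }.

Definition edges (G : sgraph) : {set {set G}} :=
  [set e | [exists x : G, exists y : G, adj x y && (e == [set x; y])]].

Definition degree (G : sgraph) (x : G) : nat := #|[set y | adj x y]|.

Definition max_degree (G : sgraph) : nat := \max_(x : G) degree x.

Definition isomorphic (G H : sgraph) : Prop :=
  exists2 f : G -> H, bijective f & forall x y, adj (f x) (f y) = adj x y.

(* The centre is [None]; the leaves are the [Some i]. *)
Definition star_rel (p : nat) : rel (option 'I_p) :=
  fun x y => (x == None) (+) (y == None).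

Lemma star_sym p : symmetric (@star_rel p).
Proof. by move=> x y; rewrite /star_rel addbC. Qed.

Lemma star_irr p : irreflexive (@star_rel p).
Proof. by move=> x; rewrite /star_rel addbb. Qed.

Definition star (p : nat) : sgraph := SGraph (@star_sym p) (@star_irr p).

Definition empty_rel (r : nat) : rel 'I_r := fun _ _ => false.

Lemma empty_sym r : symmetric (@empty_rel r).
Proof. by []. Qed.

Lemma empty_irr r : irreflexive (@empty_rel r).
Proof. by []. Qed.

Definition isolated (r : nat) : sgraph := SGraph (@empty_sym r) (@empty_irr r).

Definition union_rel (G H : sgraph) : rel (G + H)%type :=
  fun u v => match u, v with
             | inl x, inl y => adj x y
             | inr x, inr y => adj x y
             | _, _ => false
             end.

Lemma union_sym G H : symmetric (@union_rel G H).
Proof. by move=> [x|x] [y|y] //=; exact: adj_sym. Qed.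

Lemma union_irr G H : irreflexive (@union_rel G H).
Proof. by move=> [x|x] /=; exact: adj_irr. Qed.

Definition disjoint_union (G H : sgraph) : sgraph :=
  SGraph (@union_sym G H) (@union_irr G H).

Definition adjacency_mx (R : pzRingType) (G : sgraph) : 'M[R]_#|G| :=
  \matrix_(i, j) (adj (enum_val i) (enum_val j))%:R.

Definition degree_mx (R : pzRingType) (G : sgraph) : 'M[R]_#|G| :=
  diag_mx (\row_i (degree (enum_val i))%:R).

Definition laplacian_mx (R : pzRingType) (G : sgraph) : 'M[R]_#|G| :=
  degree_mx R G - adjacency_mx R G.

Lemma laplacian_mx_sym (R : pzRingType) (G : sgraph) :
  (laplacian_mx R G)^T = laplacian_mx R G.
Proof.
apply/matrixP=> i j; rewrite !mxE adj_sym eq_sym.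
by case: eqP => [->|//].
Qed.

Lemma char_poly_conj (C : fieldType) n (P D : 'M[C]_n) : P \in unitmx ->
  char_poly (invmx P *m D *m P) = char_poly D.
Proof.
move=> Pu; pose c := fun A : 'M[C]_n => map_mx (@polyC C) A.
have cPu : c (invmx P) *m c P = 1%:M by rewrite /c -map_mxM mulVmx // map_mx1.
rewrite /char_poly /char_poly_mx 2!map_mxM -/(c (invmx P)) -/(c D) -/(c P).
have -> : 'X%:M - c (invmx P) *m c D *m c P
  = c (invmx P) *m ('X%:M - c D) *m c P.
  by rewrite mulmxBr mulmxBl scalar_mxC -(mulmxA 'X%:M) cPu mulmx1.
by rewrite !det_mulmx mulrAC -det_mulmx cPu det1 mul1r.
Qed.

(* Spectral theorem over a real closed field, through R[i]. *)
Lemma symmetric_eigenvalues (R : rcfType) n (A : 'M[R]_n) : A^T = A ->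
  exists mu : n.-tuple R, sorted >=%O mu
    && (char_poly A == \prod_(i < n) ('X - (tnth mu i)%:P)).
Proof.
move=> symA; pose f := @real_complex R; pose B : 'M[R[i]]_n := map_mx f A.
have hB : B \is hermsymmx.
  apply: realsym_hermsym.
    apply/is_hermitianmxP; rewrite expr0 scale1r map_mx_id //.
    by rewrite /B map_trmx symA.
  by apply/mxOverP=> i j; rewrite mxE; apply/complex_realP; exists (A i j).
have /mxOverP dR := hermitian_spectral_diag_real hB.
have /orthomx_spectralP eB := hermitian_normalmx hB.
pose d (i : 'I_n) : R := complex.Re (spectral_diag B 0 i).
have fd i : f (d i) = spectral_diag B 0 i by exact: RRe_real.
have cA : char_poly A = \prod_(i < n) ('X - (d i)%:P).
  apply: (map_inj_poly (fmorph_inj f) (rmorph0 f)).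
  rewrite map_char_poly -/B eB char_poly_conj ?spectral_unit //.
  rewrite char_poly_trig ?diag_mx_is_trig // rmorph_prod.
  apply: eq_bigr => i _.
  by rewrite rmorphB /= map_polyX map_polyC /= mxE eqxx mulr1n -fd.
have sz : size (sort >=%O [seq d i | i <- enum 'I_n]) == n.
  by rewrite size_sort size_map size_enum_ord.
exists (Tuple sz); rewrite sort_sorted /=; last by move=> x y; exact: le_total.
rewrite -(big_tuple _ _ (Tuple sz) xpredT (fun x => 'X - x%:P)) /=.
by rewrite (perm_big _ (permEl (perm_sort _ _))) big_map big_enum cA.
Qed.

(* mu_1 >= ... >= mu_n, with multiplicity: these two conditions determine
   the tuple. *)
Definition laplacian_eigenvalues (R : rcfType) (G : sgraph) : #|G|.-tuple R :=
  xchoose (symmetric_eigenvalues (laplacian_mx_sym R G)).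

Lemma laplacian_eigenvalues_sorted (R : rcfType) (G : sgraph) :
  sorted >=%O (laplacian_eigenvalues R G).
Proof.
by case/andP: (xchooseP (symmetric_eigenvalues (laplacian_mx_sym R G))).
Qed.

Lemma char_poly_laplacian (R : rcfType) (G : sgraph) :
  char_poly (laplacian_mx R G)
    = \prod_(i < #|G|) ('X - (tnth (laplacian_eigenvalues R G) i)%:P).
Proof.
by case/andP: (xchooseP (symmetric_eigenvalues (laplacian_mx_sym R G))) => _ /eqP.
Qed.

Definition laplacian_energy (R : rcfType) (G : sgraph) : R :=
  \sum_(i < #|G|) `|tnth (laplacian_eigenvalues R G) i
                    - (2 * #|edges G|)%:R / #|G|%:R|.

(* Main.v *)
(* Let d = 2m/n. As the deviations mu_i - d sum to zero, LE(G) is twice the sum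
   of the k nonnegative ones. Write L(G) as the Laplacian of the star at a vertex
   of maximum degree plus one rank-one term per remaining edge. In the manner of
   Ky Fan's inequality, the k largest eigenvalues sum to at most
   (Delta_1 + k) + 2 (m - Delta_1), which is enough when k >= 2 or d <= 1.
   For k = 1 and d > 1, G is not a star with isolated vertices, so
   Delta_1 < m, and the bound mu_1 <= m + 1 is enough. *)
Require Import Defs.
From mathcomp Require Import all_boot all_order all_algebra.
From mathcomp Require Import spectral complex.
From mathcomp Require Import ring lra zify.
Set Implicit Arguments.
Unset Strict Implicit.
Unset Printing Implicit Defensive.

Import Order.TTheory GRing.Theory Num.Theory.
Local Open Scope ring_scope.

(** * Real and imaginary parts of a unitary diagonalisation *)

Lemma Re_sum (R : rcfType) (T : Type) (s : seq T) (P : pred T) (F : T -> R[i]) :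
  complex.Re (\sum_(x <- s | P x) F x) = \sum_(x <- s | P x) complex.Re (F x).
Proof. by apply: (big_morph (@complex.Re R)) => // [[a b] [c d]]. Qed.

Lemma Re_mul_conj (R : rcfType) (z w : R[i]) :
  complex.Re (z * w^*)
    = complex.Re z * complex.Re w + complex.Im z * complex.Im w.
Proof. by case: z w => [a b] [c d] /=; rewrite mulrN opprK. Qed.

Lemma Re_real_mul (R : rcfType) (a : R) (z : R[i]) :
  complex.Re (real_complex R a * z) = a * complex.Re z.
Proof. by case: z => [c d] /=; rewrite mul0r subr0. Qed.

(* The rows of a unitary diagonalisation over [R[i]] are split into real parts
   [p i] and imaginary parts [q i]; the rank-one projections
   [p i x * p i y + q i x * q i y] resolve the identity. *)
Lemma real_spectral_resolution (R : rcfType) (n : nat) (A : 'M[R]_n) :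
  A^T = A ->
  exists d : 'I_n -> R, exists p q : 'I_n -> 'I_n -> R,
    [/\ char_poly A = \prod_i ('X - (d i)%:P),
        forall i, \sum_x (p i x ^+ 2 + q i x ^+ 2) = 1,
        forall x y, \sum_i (p i x * p i y + q i x * q i y) = (x == y)%:R
      & forall i,
          d i = \sum_x \sum_y A x y * (p i x * p i y + q i x * q i y)].
Proof.
move=> symA; pose f := @real_complex R; pose B : 'M[R[i]]_n := map_mx f A.
have hB : B \is hermsymmx.
  apply: realsym_hermsym.
    apply/is_hermitianmxP; rewrite expr0 scale1r map_mx_id //.
    by rewrite /B map_trmx symA.
  by apply/mxOverP=> i j; rewrite mxE; apply/complex_realP; exists (A i j).
have /mxOverP dR := hermitian_spectral_diag_real hB.
have /orthomx_spectralP := hermitian_normalmx hB.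
set V := spectralmx B; set D := spectral_diag B => eB.
have uV : V \is unitarymx by exact: spectral_unitarymx.
have VVt := unitarymxP uV; have VtV := mulmx1C VVt.
have eD i : f (complex.Re (D 0 i)) = D 0 i by exact: RRe_real.
exists (fun i => complex.Re (D 0 i)).
exists (fun i x => complex.Re (V i x)), (fun i x => complex.Im (V i x)).
split.
- apply: (map_inj_poly (fmorph_inj f) (rmorph0 f)).
  rewrite map_char_poly -/B eB char_poly_conj ?spectral_unit //.
  rewrite char_poly_trig ?diag_mx_is_trig // rmorph_prod.
  apply: eq_bigr => i _.
  rewrite rmorphB /= map_polyX map_polyC /= mxE eqxx mulr1n.
  exact: (congr1 (fun z => 'X - z%:P) (esym (eD i))).
- move=> i; move/matrixP/(_ i i)/(congr1 (@complex.Re R)): VVt.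
  rewrite !mxE eqxx Re_sum => eV.
  rewrite -[RHS]/(complex.Re (true%:R : R[i])) -eV; apply: eq_bigr => x _.
  by rewrite !mxE Re_mul_conj !expr2.
- move=> x y; move/matrixP/(_ y x)/(congr1 (@complex.Re R)): VtV.
  rewrite !mxE Re_sum eq_sym => eV.
  transitivity (complex.Re ((x == y)%:R : R[i])); last by case: (x == y).
  rewrite -eV; apply: eq_bigr => i _.
  by rewrite !mxE [in RHS]mulrC Re_mul_conj.
(* As [V] is unitary, the [i]-th eigenvalue is the Hermitian form of [B] at row [i] of [V]; because
   [A] is real, its real part splits over [p i] and [q i]. *)
move=> i; have : V *m B *m (V ^t* )%sesqui = diag_mx D.
  by rewrite eB invmx_unitary // !mulmxA VVt mul1mx -mulmxA VVt mulmx1.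
move/matrixP/(_ i i)/(congr1 (@complex.Re R)).
rewrite [in RHS]mxE eqxx mulr1n => <-.
rewrite mxE Re_sum exchange_big /=; apply: eq_bigr => y _.
rewrite !mxE mulr_suml Re_sum; apply: eq_bigr => x _.
by rewrite !mxE mulrAC mulrC Re_real_mul Re_mul_conj.
Qed.

(** * Unit frames and Parseval's identity *)

(** A Parseval frame of complex unit vectors with real parts [p i] and imaginary parts [q i]. Only
    the real parts of the rank-one projections are recorded, which is all that a real quadratic form
    sees. *)
Definition resolution (R : rcfType) (J T : finType) (p q : J -> T -> R) : Prop :=
  (forall i, \sum_x (p i x ^+ 2 + q i x ^+ 2) = 1)
  /\ (forall x y, \sum_i (p i x * p i y + q i x * q i y) = (x == y)%:R).

Lemma resolution_parseval (R : rcfType) (J T : finType) (p q : J -> T -> R)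
    (b : T -> R) : resolution p q ->
  \sum_i ((\sum_x b x * p i x) ^+ 2 + (\sum_x b x * q i x) ^+ 2)
    = \sum_x b x ^+ 2.
Proof.
case=> _ ortho.
transitivity (\sum_i \sum_x \sum_y b x * b y * (p i x * p i y + q i x * q i y)).
  apply: eq_bigr => i _; rewrite !expr2 !big_distrlr -big_split /=.
  apply: eq_bigr => x _; rewrite -big_split /=.
  by apply: eq_bigr => y _; ring.
rewrite exchange_big; apply: eq_bigr => x _ /=.
rewrite exchange_big (bigD1 x) //= -mulr_sumr ortho eqxx mulr1 big1 ?addr0 //.
by move=> y /negPf ny; rewrite -mulr_sumr ortho eq_sym ny mulr0.
Qed.

(** Parseval for the difference of two basis vectors, of squared norm 2. This caps the contribution
    of one edge to any partial sum. *)
Lemma resolution_edge_sum (R : rcfType) (J T : finType) (p q : J -> T -> R)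
    (x y : T) : resolution p q -> x != y ->
  \sum_i ((p i x - p i y) ^+ 2 + (q i x - q i y) ^+ 2) = 2.
Proof.
case=> _ ortho /negPf nxy.
transitivity (\sum_i (p i x * p i x + q i x * q i x)
   + \sum_i (p i y * p i y + q i y * q i y)
   - (\sum_i (p i x * p i y + q i x * q i y)) *+ 2); last first.
  by rewrite !ortho !eqxx nxy mul0rn subr0.
rewrite -sumrMnl -sumrN -!big_split /=; apply: eq_bigr => i _; ring.
Qed.

(** * The Laplacian quadratic form and the star at a vertex *)

Lemma degreeE (R : pzRingType) (G : sgraph) (x : G) :
  (degree x)%:R = \sum_y (adj x y)%:R :> R.
Proof.
rewrite /degree -sum1_card natr_sum big_mkcond /=.
by apply: eq_bigr => y _; rewrite inE; case: (adj x y).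
Qed.

(** The factor 2 appears because ordered pairs count each edge twice. *)
Lemma edge_form (R : rcfType) (G : sgraph) (v : G -> R) :
  \sum_x \sum_y (adj x y)%:R * (v x - v y) ^+ 2
    = 2 * \sum_x \sum_y ((degree x)%:R *+ (x == y) - (adj x y)%:R) * (v x * v y).
Proof.
have row x : \sum_y ((degree x)%:R *+ (x == y) - (adj x y)%:R) * (v x * v y)
    = \sum_y (adj x y)%:R * (v x ^+ 2 - v x * v y).
  transitivity ((degree x)%:R * v x ^+ 2 - \sum_y (adj x y)%:R * (v x * v y)).
    under eq_bigr do rewrite mulrBl.
    rewrite sumrB (bigD1 x) //= eqxx mulr1n big1 ?addr0 ?expr2 // => y.
    by rewrite eq_sym => /negPf->; rewrite mul0r.
  rewrite (degreeE R) mulr_suml -sumrB; apply: eq_bigr => y _; ring.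
under [in RHS]eq_bigr do rewrite row.
rewrite mulr_natl mulr2n [X in _ = _ + X]exchange_big -big_split /=.
apply: eq_bigr => x _; rewrite -big_split /=; apply: eq_bigr => y _.
by rewrite (adj_sym y); ring.
Qed.

(* With [w = Delta e_c - sum of the e_y over the neighbours y of c], this is
   the matrix inequality [L(star) <= 1 + w w^T / (Delta + 1)]; [w] is the
   eigenvector of the star for the eigenvalue [Delta + 1]. *)
Lemma star_form (R : rcfType) (G : sgraph) (c : G) (v : G -> R) :
  \sum_y (adj c y)%:R * (v c - v y) ^+ 2
    <= \sum_y v y ^+ 2
       + (\sum_y ((degree c)%:R *+ (y == c) - (adj c y)%:R) * v y) ^+ 2
         / (degree c).+1%:R.
Proof.
set D : R := (degree c)%:R.
pose s : R := \sum_y (adj c y)%:R * v y.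
pose t : R := \sum_y (adj c y)%:R * v y ^+ 2.
have -> : \sum_y (D *+ (y == c) - (adj c y)%:R) * v y = D * v c - s.
  under eq_bigr do rewrite mulrBl.
  rewrite sumrB (bigD1 c) //= eqxx mulr1n big1 ?addr0 // => y.
  by move=> /negPf->; rewrite mul0r.
have -> : \sum_y (adj c y)%:R * (v c - v y) ^+ 2 = D * v c ^+ 2 - 2 * v c * s + t.
  rewrite /D (degreeE R) mulr_suml /s mulr_sumr -sumrB /t -big_split /=.
  by apply: eq_bigr => y _; ring.
have le_t : v c ^+ 2 + t <= \sum_y v y ^+ 2.
  rewrite /t (bigD1 c) //= [leRHS](bigD1 c) //= adj_irr mul0r add0r lerD2l.
  apply: ler_sum => y _; case: (adj c y); rewrite ?mul1r ?mul0r //.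
  exact: sqr_ge0.
have D1 : 0 < D + 1 by rewrite ltr_wpDl // ler0n.
apply: le_trans (lerD le_t (lexx _)); rewrite -[(degree c).+1%:R]natr1 -/D -subr_ge0.
(* The gap lies along the all-ones vector of the star, where the star Laplacian vanishes but the
   identity does not. *)
suff -> : v c ^+ 2 + t + (D * v c - s) ^+ 2 / (D + 1)
    - (D * v c ^+ 2 - 2 * v c * s + t) = (v c + s) ^+ 2 / (D + 1).
  by rewrite divr_ge0 ?sqr_ge0 // ltW.
by field; rewrite gt_eqF.
Qed.

(** * Partial sums of eigenvalues *)

Lemma sum_split_vertex (M : nmodType) (T : finType) (c : T) (F : T -> T -> M) :
  (forall x y, F x y = F y x) -> F c c = 0 ->
  \sum_x \sum_y F x y
    = \sum_(x | x != c) \sum_(y | y != c) F x y + (\sum_y F c y) *+ 2.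
Proof.
move=> symF Fcc; rewrite (bigD1 c) //=.
have -> : \sum_(x | x != c) \sum_y F x y
    = \sum_(x | x != c) F c x + \sum_(x | x != c) \sum_(y | y != c) F x y.
  by rewrite -big_split; apply: eq_bigr => x _; rewrite (bigD1 c) //= symF.
by rewrite (bigD1 c) //= Fcc add0r mulr2n addrA addrC.
Qed.

(** After division by [(degree c).+1], the rank-one term of [star_form] has trace exactly
    [degree c]. *)
Lemma star_weight_norm (R : rcfType) (G : sgraph) (c : G) :
  \sum_y ((degree c)%:R *+ (y == c) - (adj c y)%:R) ^+ 2
    = (degree c)%:R * (degree c).+1%:R :> R.
Proof.
rewrite (bigD1 c) //= eqxx adj_irr subr0 mulr1n -natr1 mulrDr mulr1 expr2.
congr (_ + _); rewrite (degreeE R) [RHS](bigD1 c) //= adj_irr add0r.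
apply: eq_bigr => y /negPf->; rewrite mulr0n sub0r sqrrN.
by case: (adj c y); rewrite ?expr1n ?expr0n.
Qed.

(* Ky Fan: the star at [c] contributes at most [degree c + #|I|], each of the
   remaining edges at most 2. *)
Lemma partial_sum_bound (R : rcfType) (J : finType) (G : sgraph)
    (p q : J -> G -> R) (d : J -> R) (I : {set J}) (c : G) :
  resolution p q ->
  (forall i, 2 * d i = \sum_x \sum_y (adj x y)%:R
                 * ((p i x - p i y) ^+ 2 + (q i x - q i y) ^+ 2)) ->
  \sum_(i in I) d i
    <= \sum_(x : G) (degree x)%:R - (degree c)%:R + #|I|%:R.
Proof.
move=> res dE; pose E i x y := (p i x - p i y) ^+ 2 + (q i x - q i y) ^+ 2.
have E0 i x y : 0 <= E i x y by rewrite addr_ge0 ?sqr_ge0.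
have splitE i : 2 * d i =
    \sum_(x | x != c) \sum_(y | y != c) (adj x y)%:R * E i x y
    + 2 * \sum_y (adj c y)%:R * E i c y.
  rewrite dE mulr_natl -sum_split_vertex //; last by rewrite adj_irr mul0r.
  by move=> x y; rewrite adj_sym /E; ring.
pose D : R := (degree c)%:R.
pose w y : R := D *+ (y == c) - (adj c y)%:R.
have starE i : \sum_y (adj c y)%:R * E i c y
    <= 1 + ((\sum_y w y * p i y) ^+ 2 + (\sum_y w y * q i y) ^+ 2)
           / (degree c).+1%:R.
  have := lerD (star_form c (p i)) (star_form c (q i)).
  rewrite -[X in X <= _]big_split /= addrACA -big_split /= (proj1 res i) -mulrDl.
  by under eq_bigr do rewrite -mulrDr.
(* The identity part gives 1 per index of [I]. The squares are nonnegative, so their sum may be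
   extended to all indices, where Parseval evaluates it. *)
have starI : \sum_(i in I) \sum_y (adj c y)%:R * E i c y <= #|I|%:R + D.
  apply: le_trans (ler_sum _ (fun i _ => starE i)) _.
  rewrite big_split /= sumr_const lerD2l -mulr_suml ler_pdivrMr ?ltr0Sn //.
  rewrite -star_weight_norm -(resolution_parseval _ res).
  rewrite [leRHS](bigID (mem I)) /= lerDl sumr_ge0 // => i _.
  by rewrite addr_ge0 ?sqr_ge0.
have edgeI x y : \sum_(i in I) (adj x y)%:R * E i x y <= (adj x y)%:R * 2.
  rewrite -mulr_sumr; case: (boolP (adj x y)) => [axy|_]; last by rewrite !mul0r.
  rewrite !mul1r -(resolution_edge_sum (x := x) (y := y) res).
    by rewrite [leRHS](bigID (mem I)) /= lerDl sumr_ge0 // => i _; exact: E0.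
  by apply: contraTneq axy => ->; rewrite adj_irr.
have restI : \sum_(i in I) \sum_(x | x != c) \sum_(y | y != c) (adj x y)%:R * E i x y
    <= \sum_(x | x != c) \sum_(y | y != c) (adj x y)%:R * 2.
  rewrite exchange_big /=; apply: ler_sum => x _.
  by rewrite exchange_big /=; apply: ler_sum => y _; exact: edgeI.
have degs : \sum_(x : G) (degree x)%:R
    = \sum_(x | x != c) \sum_(y | y != c) (adj x y)%:R + 2 * D :> R.
  under eq_bigr do rewrite (degreeE R).
  rewrite (@sum_split_vertex _ _ c) ?adj_irr // => [|x y]; last by rewrite adj_sym.
  by rewrite -degreeE mulr_natl.
have : 2 * \sum_(i in I) d i <= 2 * (\sum_(x : G) (degree x)%:R - D + #|I|%:R).
  rewrite mulr_sumr; under eq_bigr do rewrite splitE.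
  rewrite big_split /= -mulr_sumr degs.
  move: restI; under [X in _ <= X]eq_bigr do rewrite -mulr_suml.
  rewrite -mulr_suml; lra.
by rewrite ler_pM2l ?ltr0Sn.
Qed.

(** * Edge counts and recognition of stars *)

(** Each edge is the image of exactly two ordered adjacent pairs. *)
Lemma handshake (G : sgraph) : (\sum_(x : G) degree x = 2 * #|edges G|)%N.
Proof.
transitivity (\sum_(e in edges G) 2)%N; last by rewrite sum_nat_const mulnC.
have -> : (\sum_(x : G) degree x = \sum_(u : G * G | adj u.1 u.2) 1)%N.
  rewrite -(pair_big_dep xpredT (@adj G) (fun _ _ => 1%N)) /=.
  by apply: eq_bigr => x _; rewrite /degree -sum1_card; apply: eq_bigl => y; rewrite inE.
rewrite (partition_big (fun u : G * G => [set u.1; u.2]) (mem (edges G))) /=.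
  apply: eq_bigr => e; rewrite inE => /existsP[x /existsP[y /andP[axy /eqP->]]].
  have nxy : x != y by apply: contraTneq axy => ->; rewrite adj_irr.
  rewrite -(_ : #|[set (x, y); (y, x)]| = 2%N); last first.
    by rewrite cards2 xpair_eqE (negPf nxy).
  rewrite -sum1_card; apply: eq_bigl => [[a b]]; rewrite !inE !xpair_eqE /=.
  apply/andP/idP => [[aab /eqP exy]|].
    have : a \in [set x; y] by rewrite -exy !inE eqxx.
    have : b \in [set x; y] by rewrite -exy !inE eqxx orbT.
    rewrite !inE => /orP[] /eqP eb /orP[] /eqP ea; move: aab;
      by rewrite ea eb ?adj_irr ?eqxx ?orbT.
  by case/orP=> /andP[/eqP-> /eqP->]; rewrite ?(adj_sym y) axy ?eqxx // setUC.
move=> [x y] /= axy; rewrite inE; apply/existsP; exists x; apply/existsP.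
by exists y; rewrite axy eqxx.
Qed.

Lemma degree_sum (G : sgraph) (x : G) : degree x = (\sum_y adj x y)%N.
Proof.
by rewrite /degree -sum1_card big_mkcond /=; apply: eq_bigr => y _; rewrite inE; case: adj.
Qed.

Lemma edges_split (G : sgraph) (c : G) :
  (2 * #|edges G|
     = \sum_(x | x != c) \sum_(y | y != c) adj x y + 2 * degree c)%N.
Proof.
rewrite -handshake (degree_sum c) mul2n -addnn.
under eq_bigr do rewrite degree_sum.
rewrite [LHS](@sum_split_vertex nat _ c) ?adj_irr //.
by move=> x y; rewrite adj_sym.
Qed.

(** Among the edges meeting [u] or [v], only [uv] is counted twice. *)
Lemma adj_degree_le (G : sgraph) (u v : G) :
  adj u v -> (degree u + degree v <= #|edges G|.+1)%N.
Proof.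
move=> auv; have nvu : v != u by apply: contraTneq auv => ->; rewrite adj_irr.
have dv : degree v = (adj v u + \sum_(y | y != u) adj v y)%N.
  by rewrite degree_sum (bigD1 u).
have dv' : degree v = (adj u v + \sum_(x | (x != u) && (x != v)) adj x v)%N.
  rewrite degree_sum (bigD1 u) //= (bigD1 v) //= adj_irr add0n adj_sym.
  by congr (_ + _)%N; apply: eq_bigr => x _; rewrite adj_sym.
(* Once [u] is deleted, row [v] and column [v] of the adjacency matrix each sum to
   [degree v - 1]. *)
have := edges_split u; rewrite (bigD1 v) //=.
have : (\sum_(x | (x != u) && (x != v)) adj x v
        <= \sum_(x | (x != u) && (x != v)) \sum_(y | y != u) adj x y)%N.
  by apply: leq_sum => x _; rewrite [leqRHS](bigD1 v) //= leq_addr.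
move: dv dv'; rewrite (adj_sym v u) auv; lia.
Qed.

Lemma degree_lt_card (G : sgraph) (c : G) : (degree c < #|G|)%N.
Proof.
rewrite -cardsT; apply: proper_card; rewrite properT.
by apply/negP => /eqP/setP/(_ c); rewrite !inE adj_irr.
Qed.

(** Every edge meets [c], so the other vertices are either leaves at [c] or isolated. *)
Lemma degree_eq_edges_isomorphic (G : sgraph) (c : G) :
  degree c = #|edges G| ->
  isomorphic G (disjoint_union (star (degree c)) (isolated (#|G| - degree c - 1))).
Proof.
move=> dc; have noedge x y : x != c -> y != c -> adj x y = false.
  move=> xc yc; have /eqP := edges_split c; rewrite -dc -[eqbLHS]add0n eqn_add2r.
  rewrite eq_sym sum_nat_eq0 => /forallP/(_ x); rewrite xc sum_nat_eq0 /=.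
  by move=> /forallP/(_ y); rewrite yc /= eqb0 => /negPf.
pose N := [set y | adj c y]; pose S := ~: (c |: N).
have cN : c \notin N by rewrite inE adj_irr.
have cardS : #|S| = (#|G| - degree c - 1)%N.
  by rewrite cardsCs setCK cardsU1 cN -[#|N|]/(degree c); lia.
rewrite -cardS -[degree c]/#|N|.
(* The map goes from the model to [G], where [enum_val] is explicit; injectivity and equal
   cardinalities then give the inverse. *)
pose g (u : option 'I_#|N| + 'I_#|S|) : G :=
  match u with
  | inl None => c | inl (Some i) => enum_val i | inr j => enum_val j
  end.
have gN (i : 'I_#|N|) : adj c (enum_val i) by have := enum_valP i; rewrite inE.
have gS (j : 'I_#|S|) : enum_val j != c /\ adj c (enum_val j) = false.
  by have := enum_valP j; rewrite !inE negb_or => /andP[-> /negPf].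
have gc (i : 'I_#|N|) : enum_val i != c.
  by apply: contraTneq (gN i) => ->; rewrite adj_irr.
have gI : injective g.
  move=> [[i|]|j] [[i'|]|j'] //= e.
  - by rewrite (enum_val_inj e).
  - by have := gc i; rewrite e eqxx.
  - by have := gN i; rewrite e (gS j').2.
  - by have := gc i'; rewrite -e eqxx.
  - by have := (gS j').1; rewrite -e eqxx.
  - by have := gN i'; rewrite -e (gS j).2.
  - by have := (gS j).1; rewrite e eqxx.
  - by rewrite (enum_val_inj e).
have [|f gK fK] := inj_card_bij gI.
  rewrite card_sum card_option !card_ord cardS -[#|N|]/(degree c).
  by have := degree_lt_card c; lia.
exists f; first by exists g.
suff gadj (u v : disjoint_union (star #|N|) (isolated #|S|)) :
    adj u v = adj (g u) (g v) by move=> x y; rewrite gadj !fK.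
case: u v => [[i|]|j] [[i'|]|j'] //=.
- by rewrite noedge ?gc.
- by rewrite adj_sym gN.
- by rewrite noedge ?gc ?(gS _).1.
- by rewrite gN.
- by rewrite adj_irr.
- by rewrite (gS _).2.
- by rewrite noedge ?gc ?(gS _).1.
- by rewrite adj_sym (gS _).2.
- by rewrite noedge ?(gS _).1.
Qed.

(** * Upper bound for a single eigenvalue *)

Lemma laplacian_enum_rank (R : pzRingType) (G : sgraph) (x y : G) :
  laplacian_mx R G (enum_rank x) (enum_rank y)
    = (degree x)%:R *+ (x == y) - (adj x y)%:R.
Proof. by rewrite !mxE !enum_rankK (inj_eq enum_rank_inj). Qed.

Lemma sum_enum_rank (M : nmodType) (T : finType) (F : 'I_#|T| -> M) :
  \sum_i F i = \sum_x F (enum_rank x).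
Proof.
by rewrite (reindex (@enum_rank T)) //; apply: onW_bij; exact: enum_rank_bij.
Qed.

(* At an edge [uv] maximising [|f u - f v|], subtracting the eigenvalue equations
   at [u] and [v] bounds the eigenvalue by [degree u + degree v]. *)
Lemma laplacian_eigenvalue_le (R : rcfType) (G : sgraph) (a : R) :
  eigenvalue (laplacian_mx R G) a -> a <= #|edges G|.+1%:R.
Proof.
case/eigenvalueP=> v eigv nz_v.
have [a_le0|a_gt0] := leP a 0; first exact: le_trans a_le0 (ler0n _ _).
pose f x := v 0 (enum_rank x).
have eigf x : a * f x = \sum_y (adj x y)%:R * (f x - f y).
  have := congr1 (fun w : 'rV_#|G| => w 0 (enum_rank x)) eigv.
  rewrite !mxE -/(f x) => <-; rewrite sum_enum_rank.
  under eq_bigr do rewrite laplacian_enum_rank -/(f _) mulrBr.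
  under [RHS]eq_bigr do rewrite mulrBr.
  rewrite !sumrB (bigD1 x) //= eqxx mulr1n big1 ?addr0; last first.
    by move=> y /negPf->; rewrite mulr0.
  rewrite (degreeE R) mulrC mulr_suml; congr (_ - _).
  by apply: eq_bigr => y _; rewrite mulrC adj_sym.
have [x0 fx0] : exists x, f x != 0.
  case/rV0Pn: nz_v => i vi; exists (enum_val i); by rewrite /f enum_valK.
(* Otherwise the eigenvalue equation at [x0] would read [a * f x0 = 0] with [a > 0]. Hence the
   maximal difference over edges is positive and can be cancelled. *)
have [y0 ax0 fxy0] : exists2 y, adj x0 y & f x0 != f y.
  apply/exists_inP; apply: contraTT fx0; rewrite negb_exists_in => /forall_inP all_eq.
  rewrite negbK -(mulrI_eq0 _ (lregP (lt0r_neq0 a_gt0))) eigf big1 // => y _.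
  have [/all_eq|_] := boolP (adj x0 y); last by rewrite mul0r.
  by rewrite negbK => /eqP->; rewrite subrr mulr0.
pose P (u : G * G) := adj u.1 u.2.
pose F (u : G * G) := `|f u.1 - f u.2|.
have Px0 : P (x0, y0) by [].
case: (Order.TotalTheory.arg_maxP F Px0) => [[u w]] auw maxF.
have M_gt0 : 0 < F (u, w).
  by apply: lt_le_trans (maxF _ Px0); rewrite normr_gt0 subr_eq0.
have bound x : `|a * f x| <= (degree x)%:R * F (u, w).
  rewrite eigf (degreeE R) mulr_suml; apply: le_trans (ler_norm_sum _ _ _) _.
  apply: ler_sum => y _; rewrite normrM normr_nat.
  have [axy|_] := boolP (adj x y); last by rewrite !mul0r.
  by rewrite !mul1r; exact: (maxF (x, y)).
have : a * F (u, w) <= (degree u + degree w)%:R * F (u, w).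
  rewrite -{1}(gtr0_norm a_gt0) -normrM mulrBr natrD mulrDl.
  by apply: le_trans (ler_normB _ _) _; exact: lerD.
rewrite ler_pM2r // => /le_trans; apply; rewrite ler_nat.
exact: adj_degree_le.
Qed.

(** * Spectrum, trace and the energy bound *)

Lemma laplacian_resolution (R : rcfType) (G : sgraph) :
  exists mu : 'I_#|G| -> R, exists p q : 'I_#|G| -> G -> R,
    [/\ laplacian_energy R G
          = \sum_i `|mu i - (2 * #|edges G|)%:R / #|G|%:R|,
        forall i, eigenvalue (laplacian_mx R G) (mu i),
        resolution p q
      & forall i, 2 * mu i = \sum_x \sum_y (adj x y)%:R
                    * ((p i x - p i y) ^+ 2 + (q i x - q i y) ^+ 2)].
Proof.
have [mu [p [q [charE unit_pq res_pq muE]]]] :=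
  real_spectral_resolution (laplacian_mx_sym R G).
exists mu, (fun i x => p i (enum_rank x)), (fun i x => q i (enum_rank x)); split.
(* Both families are the roots of the same split characteristic polynomial, so they agree up to
   order, and the energy does not depend on the order. *)
- have : perm_eq (laplacian_eigenvalues R G) [seq mu i | i <- enum 'I_#|G|].
    apply: prod_XsubC_eq; rewrite big_map big_enum /= -charE.
    by rewrite char_poly_laplacian big_tuple.
  move=> eq_mu; rewrite /laplacian_energy.
  rewrite -(big_tuple _ _ (laplacian_eigenvalues R G) xpredT
              (fun x => `|x - (2 * #|edges G|)%:R / #|G|%:R|)) /=.
  by rewrite (perm_big _ eq_mu) big_map big_enum.
- move=> i; rewrite eigenvalue_root_char charE (bigD1 i) //= rootM root_XsubC.
  by rewrite eqxx.
- split=> [i|x y]; first by rewrite -(unit_pq i) sum_enum_rank.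
  by rewrite res_pq (inj_eq enum_rank_inj).
move=> i; under eq_bigr do under eq_bigr do rewrite mulrDr.
under eq_bigr do rewrite big_split /=.
rewrite big_split /= !edge_form -mulrDr muE; congr (_ * _).
rewrite sum_enum_rank -big_split /=; apply: eq_bigr => x _.
rewrite sum_enum_rank -big_split /=; apply: eq_bigr => y _.
by rewrite laplacian_enum_rank mulrDr.
Qed.

(** Summed over all indices, each ordered adjacent pair contributes 2, so twice the trace is twice
    the degree sum. *)
Lemma resolution_trace (R : rcfType) (J : finType) (G : sgraph)
    (p q : J -> G -> R) (mu : J -> R) :
  resolution p q ->
  (forall i, 2 * mu i = \sum_x \sum_y (adj x y)%:R
                 * ((p i x - p i y) ^+ 2 + (q i x - q i y) ^+ 2)) ->
  \sum_i mu i = (2 * #|edges G|)%:R.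
Proof.
move=> res muE; apply: (mulfI (x := 2)); first by rewrite pnatr_eq0.
rewrite -handshake natr_sum !mulr_sumr.
under eq_bigr do rewrite muE.
rewrite exchange_big; apply: eq_bigr => x _ /=.
rewrite exchange_big (degreeE R) mulr_sumr; apply: eq_bigr => y _ /=.
rewrite -mulr_sumr mulrC; have [axy|_] := boolP (adj x y); last by rewrite !mulr0.
congr (_ * _); rewrite resolution_edge_sum //.
by apply: contraTneq axy => ->; rewrite adj_irr.
Qed.

Lemma sum_norm_centered (R : realDomainType) (J : finType) (F : J -> R) :
  \sum_i F i = 0 -> \sum_i `|F i| = 2 * \sum_(i | 0 <= F i) F i.
Proof.
rewrite (bigID (fun i => 0 <= F i)) => /= /eqP; rewrite addr_eq0 => /eqP sumF.
rewrite (bigID (fun i => 0 <= F i)) /= mulr_natl mulr2n {2}sumF -sumrN.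
congr (_ + _); apply: eq_bigr => i; first exact: ger0_norm.
by rewrite -ltNge => /ltr0_norm.
Qed.

Theorem theorem4p4 (R : rcfType) (G : sgraph) (n m Delta1 : nat)
    (order_G : #|G| = n) (size_G : #|edges G| = m)
    (max_degree_G : max_degree G = Delta1)
    (m_ge : (n%:R / 2 : R) <= m%:R)
    (not_star : forall r : nat,
       (r + 2 <= uphalf n)%N \/ (r + 2 = n)%N ->
       ~ isomorphic G (disjoint_union (star (n - r - 1)%N) (isolated r))) :
  laplacian_energy R G
    <= 4 * m%:R - 2 * Delta1%:R - 8 * m%:R / n%:R + 4.
Proof.
have [mu [p [q [-> eig_mu res muE]]]] := laplacian_resolution R G.
have trace := resolution_trace res muE.
have -> : (2 * #|edges G|)%:R / #|G|%:R = (2 * m)%:R / n%:R :> R.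
  by rewrite order_G size_G.
rewrite size_G in trace.
(* For [n = 0] the inverse of zero is zero: the energy is an empty sum and the bound reads
   [4 * m + 4]. *)
have [n0|n_gt0] := posnP n.
  have noV (x : G) : False by have := fintype0 x; rewrite order_G; exact.
  rewrite big1 => [|i _]; last by case: (noV (enum_val i)).
  have D0 : Delta1 = 0%N by rewrite -max_degree_G /max_degree big1.
  by rewrite n0 D0 invr0 !mulr0 !subr0 addr_ge0 // mulr_ge0.
have [|c maxc] := @bigop.eq_bigmax G (@degree G); first by rewrite order_G.
have dc : degree c = Delta1 by rewrite -max_degree_G /max_degree maxc.
pose d : R := (2 * m)%:R / n%:R.
have nR : (0 : R) < n%:R by rewrite ltr0n.
have nd : d * n%:R = 2 * m%:R by rewrite /d divfK ?gt_eqF // natrM.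
have d_ge1 : 1 <= d.
  by rewrite -(ler_pM2r nR) nd mul1r; move: m_ge; rewrite ler_pdivrMr // mulrC.
pose I := [set i | 0 <= mu i - d].
have center : \sum_i (mu i - d) = 0.
  by rewrite sumrB trace sumr_const card_ord order_G -[d *+ n]mulr_natr nd natrM subrr.
rewrite (sum_norm_centered center).
have -> : \sum_(i | 0 <= mu i - d) (mu i - d) = \sum_(i in I) mu i - #|I|%:R * d.
  rewrite mulr_natl -sumr_const -sumrB.
  by apply: eq_bigl => i; rewrite inE.
have -> : 8 * m%:R / n%:R = 4 * d by rewrite /d natrM; ring.
suff : \sum_(i in I) mu i - #|I|%:R * d <= 2 * m%:R - Delta1%:R - 2 * d + 2 by lra.
have := partial_sum_bound I c res muE.
rewrite -natr_sum handshake size_G dc natrM => star_bound.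
(* With [k = #|I|], the star bound leaves [k * (1 - d)], which is at most [2 * (1 - d)] for [k >= 2]
   because [d >= 1]. *)
have [I_ge2|] := leqP 2 #|I|.
  have k_ge2 : (2 : R) <= #|I|%:R by rewrite ler_nat.
  have : (#|I|%:R - 2) * 1 <= (#|I|%:R - 2) * d by rewrite ler_wpM2l ?subr_ge0.
  lra.
(* The case [k = 0] is impossible: all deviations would be negative, yet they sum to zero over a
   nonempty index set. *)
rewrite ltnS leq_eqVlt ltnS leqn0 => /orP[/eqP I1|/eqP/cards0_eq I0]; last first.
  have i0 : 'I_#|G| by exact: (enum_rank c).
  have neg i : mu i - d < 0.
    by have := in_set0 i; rewrite -I0 inE => /negbT; rewrite -ltNge.
  have : \sum_i (mu i - d) < 0.
    rewrite (bigD1 i0) //= -[ltRHS]addr0 ltr_leD // sumr_le0 // => i _.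
    exact: ltW.
  by rewrite center ltxx.
rewrite I1 mul1r in star_bound *.
have [d_le1|d_gt1] := leP d 1; first lra.
have /cards1P[i Ii] : #|I| == 1%N by rewrite I1.
have := laplacian_eigenvalue_le (eig_mu i); rewrite size_G -natr1 Ii big_set1.
(* Subtracting [d] from [m + 1] meets the target exactly when this inequality holds. *)
suff : d <= m%:R - Delta1%:R + 1 by lra.
have n_lt : (n < 2 * m)%N.
  by rewrite -(ltr_nat R) natrM -nd -[ltLHS]mul1r ltr_pM2r.
have split := edges_split c; rewrite size_G dc in split.
have D_lt_n := degree_lt_card c; rewrite order_G dc in D_lt_n.
have D_lt_m : (Delta1 < m)%N.
  rewrite ltn_neqAle; apply/andP; split; last lia.
  (* Since [m = Delta1 < n < 2m], the value [r = n - m - 1] is not truncated and [r + 2 = n - m + 1]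
     is at most the upper half of [n]. *)
  apply/eqP => Dm; apply: (not_star (n - m - 1)%N); first by left; lia.
  have := @degree_eq_edges_isomorphic G c; rewrite size_G order_G dc Dm.
  by move=> /(_ erefl); congr (isomorphic G (disjoint_union (star _) _)); lia.
have deg_sum : (2 * m <= n * Delta1)%N.
  rewrite -size_G -handshake -order_G -sum_nat_const; apply: leq_sum => x _.
  by rewrite -max_degree_G /max_degree (leq_bigmax (F := @degree G)).
have : (2 * m <= (m + 1 - Delta1) * n)%N.
  (* If [m < n], the factor [m + 1 - Delta1] is at least 2. If [m >= n >= 2], then [Delta1 <= n - 1]
     reduces the claim to [(n - 2) * (m - n) >= 0]. For [n = 1], [deg_sum] forces [m = 0], against
     [n < 2m]. *)
  have [m_lt_n|n_le_m] := ltnP m n; first nia.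
  have [n1|n_gt1] := leqP n 1; nia.
rewrite -(ler_nat R) !natrM natrB; last lia.
rewrite natrD -nd ler_pM2r //; lra.
Qed.
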